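(* Let $N_0,N_1\ge 1$ be integers, let $\Sigma_x\in\mathbb{R}^{N_0\times N_0}$ be positive definite with eigenvalues $\lambda^x_1\ge\cdots\ge\lambda^x_{N_0}>0$, and let $\sigma^2>0$. Let $X\sim\mathcal{N}(0;\Sigma_x)$, and for $W\in\mathbb{R}^{N_1\times N_0}$, $b\in\mathbb{R}^{N_1}$ let $Z\mid X,W,b\sim\mathcal{N}(WX+b;\,\sigma^2 I_{N_1})$. Let $\tilde N=\min(N_0,N_1)$, let $K$ be an integer with $1\le K<\tilde N$, and let $F$ satisfy $\rho_{\tilde N-K}\le F\le\rho_{\tilde N-K+1}$. Then $$\mathrm{MMI}(X;Z)=\frac{\tilde N-K}{2}\log\!\left(\frac{F+\sigma^2\,\mathrm{Tr}(\Sigma_{x,\tilde N-K}^{-1})}{\sigma^2(\tilde N-K)}\right)+\frac12\log|\Sigma_{x,\tilde N-K}|.$$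
   Context: $\mathcal{N}(\mu;A)$ denotes the Gaussian distribution with mean $\mu$ and covariance $A$; logarithms are natural and $|\cdot|$ denotes determinant. For $k=1,\dots,\tilde N$, $\Sigma_{x,k}=\mathrm{diag}(\lambda^x_1,\dots,\lambda^x_k)$ and $\rho_k\triangleq\sigma^2\left(\frac{k}{\lambda^x_k}-\sum_{i=1}^k\frac{1}{\lambda^x_i}\right)$. $I_{W,b}(X;Z)$ is the mutual information between $X$ and $Z$ under the joint law determined by $W,b$, and $\mathrm{MMI}(X;Z)\triangleq\sup\{I_{W,b}(X;Z): W\in\mathbb{R}^{N_1\times N_0},\ b\in\mathbb{R}^{N_1},\ \mathrm{Tr}(W^TW)\le F\}$. *)

(* Defs.v *)
From HB Require Import structures.
From mathcomp Require Import all_boot all_order all_algebra.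
From mathcomp Require Import all_classical all_reals all_analysis.
Set Implicit Arguments. Unset Strict Implicit. Unset Printing Implicit Defensive.
Import Order.TTheory GRing.Theory Num.Theory.
Local Open Scope classical_set_scope.
Local Open Scope ring_scope.

Section Defs.
Variable R : realType.

Definition gauss_pdf (n : nat) (mu : 'cV[R]_n) (A : 'M[R]_n) (x : 'cV[R]_n) : R :=
  (Num.sqrt ((2 * pi) ^+ n * \det A))^-1 *
  expR (- (1 / 2) * ((x - mu)^T *m invmx A *m (x - mu)) 0 0).

Fixpoint iint (n : nat) (f : seq R -> \bar R) : \bar R :=
  match n with
  | 0%N => f [::]
  | n'.+1 => (\int[@lebesgue_measure R]_(t in setT) iint n' (fun s => f (t :: s)))%E
  end.

Definition vec_of_seq (n : nat) (s : seq R) : 'cV[R]_n := \col_(i < n) nth 0 s i.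

Definition int_Rn (n : nat) (f : 'cV[R]_n -> \bar R) : \bar R :=
  iint n (fun s => f (vec_of_seq n s)).

Definition pX (N0 : nat) (Sx : 'M[R]_N0) (x : 'cV[R]_N0) : R := gauss_pdf 0 Sx x.

Definition pZgX (N0 N1 : nat) (s2 : R) (W : 'M[R]_(N1, N0)) (b : 'cV[R]_N1)
  (x : 'cV[R]_N0) (z : 'cV[R]_N1) : R := gauss_pdf (W *m x + b) (s2%:M) z.

Definition pXZ (N0 N1 : nat) (Sx : 'M[R]_N0) (s2 : R) (W : 'M[R]_(N1, N0))
  (b : 'cV[R]_N1) (x : 'cV[R]_N0) (z : 'cV[R]_N1) : R :=
  pX Sx x * pZgX s2 W b x z.

Definition pZ (N0 N1 : nat) (Sx : 'M[R]_N0) (s2 : R) (W : 'M[R]_(N1, N0))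
  (b : 'cV[R]_N1) (z : 'cV[R]_N1) : R :=
  fine (int_Rn (fun x => (pXZ Sx s2 W b x z)%:E)).

Definition MI (N0 N1 : nat) (Sx : 'M[R]_N0) (s2 : R) (W : 'M[R]_(N1, N0))
  (b : 'cV[R]_N1) : \bar R :=
  int_Rn (fun x => int_Rn (fun z =>
    (pXZ Sx s2 W b x z * ln (pXZ Sx s2 W b x z / (pX Sx x * pZ Sx s2 W b z)))%:E)).

Definition MMI (N0 N1 : nat) (Sx : 'M[R]_N0) (s2 F : R) : \bar R :=
  ereal_sup [set MI Sx s2 W b | W in [set W : 'M[R]_(N1, N0) | \tr (W^T *m W) <= F]
                               & b in [set: 'cV[R]_N1]].

(* lam is 0-indexed: lam i = lambda^x_{i+1}. *)
Definition Sigma_xk (lam : nat -> R) (k : nat) : 'M[R]_k := diag_mx (\row_(i < k) lam i).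

(* rho_k = s2 (k / lambda_k - sum_{i=1}^k 1/lambda_i), k 1-indexed. *)
Definition rho (lam : nat -> R) (s2 : R) (k : nat) : R :=
  s2 * (k%:R / lam k.-1 - \sum_(i < k) (lam i)^-1).

End Defs.

(* Main.v *)
(* The mutual information of the linear Gaussian channel is [1/2 ln (det C / s2^N1)] with
   [C = s2 I + W Sx W^T]: completing the square shows that [Z] is Gaussian with covariance [C],
   so that the log-likelihood ratio is a constant plus a quadratic form whose expectation
   vanishes. All Gaussian integrals are evaluated one coordinate at a time, an LDL^T step of
   the inverse covariance decoupling the first coordinate from the remaining ones.

   In an orthonormal eigenbasis of [Sx], Sylvester's identity and Hadamard's inequality bound
   [det C / s2^N1] by the product of the [1 + lam_i p_i / s2], where [p_i] is the squared norm of
   the [i]-th column of [W] in that basis, so that the [p_i] sum to [Tr (W^T W) <= F]. With the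
   water level [nu = (F + s2 \sum_(i < k) 1 / lam_i) / (s2 k)], the constraints on [F] say that
   [1 / lam_i <= nu] exactly on the first [k] modes (up to ties), so the bound
   [r <= exp (r - 1)] gives the optimum, attained by [p_i = s2 (nu - 1 / lam_i)] for [i < k]. *)

Require Import Defs.
From HB Require Import structures.
From mathcomp Require Import all_boot all_order all_algebra.
From mathcomp Require Import all_classical all_reals all_analysis.
From mathcomp Require Import measurable_realfun ring.
Set Implicit Arguments. Unset Strict Implicit. Unset Printing Implicit Defensive.
Import Order.TTheory GRing.Theory Num.Theory.
Import numFieldNormedType.Exports.
Local Open Scope classical_set_scope.
Local Open Scope ring_scope.

(** * Gaussian moments on the line *)

Section OneDim.
Variable R : realType.
Notation mu := (@lebesgue_measure R).
Implicit Types (s m t : R) (f : R -> R).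

(** The parameter [s] is a precision, the inverse of a variance, so that the pivots of an inverse
    covariance matrix can be plugged in directly. *)
Definition gsn s t : R := expR (- (1 / 2) * (s * t ^+ 2)).

Lemma continuous_gsn s : continuous (gsn s).
Proof.
move=> t; apply: (@continuous_comp _ _ _ (fun t => - (1 / 2) * (s * t ^+ 2)) expR).
  apply: cvgM; first exact: cvg_cst.
  apply: cvgM; first exact: cvg_cst.
  exact: exprn_continuous.
exact: continuous_expR.
Qed.

Let mE (D : set (measurableTypeR R)) f : continuous f -> measurable_fun D (EFin \o f).
Proof.
move=> cf; apply: measurable_funTS; apply/measurable_EFinP.
exact: continuous_measurable_fun.
Qed.

(** Brings integrals to the half-line, where a primitive evaluates them, and makes odd parts cancel
    pointwise. *)
Lemma ge0_integral_fold f : (forall t, 0 <= f t) -> continuous f ->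
  (\int[mu]_t (f t)%:E = \int[mu]_(t in `[0%R, +oo[) (f t + f (- t))%:E)%E.
Proof.
move=> f0 cf.
have mf : measurable_fun [set: R] f by exact: continuous_measurable_fun.
have mfN : measurable_fun [set: R] (f \o -%R).
  by apply: measurableT_comp => //; exact: oppr_measurable.
under [RHS]eq_integral do rewrite EFinD.
rewrite ge0_integralD//=; last 4 first.
- by move=> t _; rewrite lee_fin.
- exact/measurable_EFinP/measurable_funTS.
- by move=> t _; rewrite lee_fin.
- exact/measurable_EFinP/measurable_funTS.
rewrite -(setUv [set x : R | 0 <= x]%R) ge0_integral_setU//= ; last 5 first.
- by rewrite -set_itvcy.
- by apply: measurableC; rewrite -set_itvcy.
- by apply/measurable_EFinP; rewrite setUv.
- by move=> x _; rewrite lee_fin.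
- exact/disj_setPCl.
rewrite -set_itvcy// setCitvr; congr (_ + _)%E.
rewrite integral_itv_bndo_bndc; last exact/measurable_EFinP/measurable_funTS.
rewrite -{1}oppr0 ge0_integration_by_substitutionNy//.
exact: continuous_subspaceT.
Qed.

Lemma ge0_integral_center f m : (forall t, 0 <= f t) -> continuous f ->
  (\int[mu]_t (f (t - m))%:E = \int[mu]_t (f t)%:E)%E.
Proof.
move=> f0 cf.
have dF (x : R) : is_derive x 1 (fun t => t - m) (1 : R).
  by apply: is_derive_eq; rewrite subr0.
have F'E : (fun t => t - m)^`()%classic = cst (1 : R).
  by apply/funext => x; rewrite derive1E; exact: derive_val.
rewrite (@increasing_ge0_integration_by_substitutionT _ (fun t => t - m) f)//.
- by apply: eq_integral => t _; rewrite F'E /= mulr1.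
- by move=> x y xy; rewrite ltrD2r.
- by rewrite F'E => x; exact: cvg_cst.
- by rewrite F'E; exact: is_cvg_cst.
- by rewrite F'E; exact: is_cvg_cst.
- exact: cvg_addrr_Ny.
- exact: cvg_addrr.
Qed.

(** The normal density of standard deviation [1 / sqrt s] is a constant multiple of [gsn s] and has
    total mass one. *)
Lemma integral_gsn s : 0 < s ->
  (\int[mu]_t (gsn s t)%:E = (Num.sqrt (2 * pi / s))%:E)%E.
Proof.
move=> s0; pose sg := (Num.sqrt s)^-1.
have sg0 : sg != 0 by rewrite invr_neq0// sqrtr_eq0 -ltNge.
have sg2 : sg ^+ 2 = s^-1 by rewrite exprVn sqr_sqrtr// ltW.
have pE t : normal_pdf 0 sg t = normal_peak sg * gsn s t.
  rewrite /normal_pdf (negPf sg0) /normal_fun subr0 sg2; congr (_ * expR _).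
  by rewrite -mulr_natr; field; rewrite gt_eqF.
have := integral_normal_pdf 0 sg.
under eq_integral do rewrite pE EFinM.
rewrite ge0_integralZl//=; last 3 first.
- by apply: mE; exact: continuous_gsn.
- by move=> t _; rewrite lee_fin expR_ge0.
- by rewrite lee_fin normal_peak_ge0.
have -> : Num.sqrt (2 * pi / s) = (normal_peak sg)^-1.
  by rewrite /normal_peak invrK sg2 -mulr_natr; congr Num.sqrt; ring.
(* An infinite integral times the positive peak could not equal one. *)
move: (integral _ _ _) => [r||] /=; last 2 first.
- by rewrite gt0_muley// lte_fin normal_peak_gt0.
- by rewrite gt0_muleNy// lte_fin normal_peak_gt0.
rewrite -EFinM => -[prE]; congr (_%:E).
apply: (mulfI (lt0r_neq0 (normal_peak_gt0 sg0))).
by rewrite prE divff// lt0r_neq0// normal_peak_gt0.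
Qed.

(** The exponents differ by a square over [2 * s]. As [expR t] dominates both [1] and [t] for
    [t >= 0], this majorant serves [gsn s t] and [t * gsn s t] alike on the half-line. *)
Let decay s t : 0 < s -> expR t * gsn s t <= expR (2 / s) * expR (- t).
Proof.
move=> s0; rewrite -!expRD ler_expR -subr_ge0.
have -> : 2 / s - t - (t + - (1 / 2) * (s * t ^+ 2)) = (s * t - 2) ^+ 2 / (2 * s).
  by field; rewrite gt_eqF.
by rewrite divr_ge0 ?sqr_ge0// mulr_ge0// ltW.
Qed.

Let cvg_decay (C : R) : C * expR (- t) @[t --> +oo] --> 0.
Proof. by rewrite -[X in _ --> X](mulr0 C); apply: cvgM; [exact: cvg_cst|exact: cvgr_expR]. Qed.

Let cvg_t_gsn s : 0 < s -> t * gsn s t @[t --> +oo] --> 0.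
Proof.
move=> s0; apply: (@squeeze_cvgr _ _ _ _ (cst 0) (fun t => expR (2 / s) * expR (- t))).
- near=> t; apply/andP; split; first by rewrite mulr_ge0 ?expR_ge0.
  apply: le_trans (decay t s0); rewrite ler_wpM2r ?expR_ge0//.
  by rewrite (le_trans _ (expR_ge1Dx t))// lerDr.
- exact: cvg_cst.
- exact: cvg_decay.
Unshelve. all: by end_near. Qed.

Let dexpN (C x : R) : is_derive x 1 (fun t : R => - (C * expR (- t))) (C * expR (- x)).
Proof. by apply: is_derive_eq; rewrite /= /GRing.scale/=; ring. Qed.

Let integral_decay (C : R) : 0 <= C ->
  (\int[mu]_(t in `[0%R, +oo[) (C * expR (- t))%:E = C%:E)%E.
Proof.
move=> C0.
have dF y := dexpN C y.
rewrite (@ge0_continuous_FTC2y _ _ (fun t => - (C * expR (- t))) 0 0).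
- by rewrite oppr0 expR0 mulr1 EFinN oppeK add0e.
- by move=> x _; rewrite mulr_ge0 ?expR_ge0.
- apply: continuous_subspaceT => x; apply: cvgM; first exact: cvg_cst.
  by apply: (@continuous_comp _ _ _ -%R expR); [exact: oppr_continuous|exact: continuous_expR].
- by rewrite -[X in _ --> X]oppr0; apply: cvgN; exact: cvg_decay.
- by move=> x _; apply: ex_derive.
- apply: cvg_at_right_filter.
  by have /derivable1_diffP/differentiable_continuous := @ex_derive _ _ _ _ _ _ _ (dF 0).
- by move=> x _; rewrite derive1E derive_val.
Qed.

Let st2_ge0 s t : 0 < s -> 0 <= s * t ^+ 2 * gsn s t.
Proof. by move=> s0; rewrite mulr_ge0 ?expR_ge0// mulr_ge0 ?sqr_ge0// ltW. Qed.

(** Integration by parts: [t * gsn s t] vanishes at [0] and at infinity, and the derivative of its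
    opposite is [(s * t ^+ 2 - 1) * gsn s t]. *)
Let half_second_moment s : 0 < s ->
  (\int[mu]_(t in `[0%R, +oo[) (s * t ^+ 2 * gsn s t)%:E =
   \int[mu]_(t in `[0%R, +oo[) (gsn s t)%:E)%E.
Proof.
move=> s0; pose C := expR (2 / s); have C0 : 0 <= C by exact: expR_ge0.
(* That derivative is negative near [0]. Adding [C * expR (- t)], which dominates [gsn s t], gives
   the nonnegative integrand that the fundamental theorem asks for; the extra mass [C] is subtracted
   at the end. *)
pose f t := (s * t ^+ 2 - 1) * gsn s t + C * expR (- t).
have dF x : is_derive (x : R) 1 (fun t => - (t * gsn s t) - C * expR (- t)) (f x).
  by rewrite /f /gsn; apply: is_derive_eq; rewrite /= /GRing.scale/=; field.
have gC t : 0 <= t -> gsn s t <= C * expR (- t).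
  move=> t0; apply: le_trans (decay t s0); rewrite ler_peMl ?expR_ge0//.
  by rewrite (le_trans _ (expR_ge1Dx t))// lerDl.
have cg := @continuous_gsn s.
have cdec : continuous (fun t : R => C * expR (- t)).
  move=> y; apply: cvgM; first exact: cvg_cst.
  by apply: (@continuous_comp _ _ _ -%R expR); [exact: oppr_continuous|exact: continuous_expR].
have csq : continuous (fun t : R => s * t ^+ 2).
  by move=> x; apply: cvgM; [exact: cvg_cst|exact: exprn_continuous].
have c2 : continuous (fun t : R => s * t ^+ 2 * gsn s t).
  by move=> x; apply: cvgM; [exact: csq|exact: cg].
have cf : continuous f.
  move=> x; apply: cvgD; last exact: cdec.
  by apply: cvgM; [apply: cvgB; [exact: csq|exact: cvg_cst]|exact: cg].
have f0 t : 0 <= t -> 0 <= f t.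
  move=> t0; rewrite /f mulrBl mul1r -addrA addr_ge0 ?st2_ge0//.
  by rewrite addrC subr_ge0 gC.
have If : (\int[mu]_(t in `[0%R, +oo[) (f t)%:E = C%:E)%E.
  rewrite (@ge0_continuous_FTC2y _ _ (fun t => - (t * gsn s t) - C * expR (- t)) 0 0)//.
  - by rewrite -EFinB; congr _%:E; rewrite oppr0 expR0; ring.
  - exact: continuous_subspaceT.
  - rewrite -[X in _ --> X]subr0 -{1}[0]oppr0; apply: cvgB; last exact: cvg_decay.
    by apply: cvgN; exact: cvg_t_gsn.
  - apply: cvg_at_right_filter.
    by have /derivable1_diffP/differentiable_continuous := @ex_derive _ _ _ _ _ _ _ (dF 0).
  - by move=> x _; rewrite derive1E derive_val.
have : (\int[mu]_(t in `[0%R, +oo[) ((s * t ^+ 2 * gsn s t)%:E + (C * expR (- t))%:E) =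
        \int[mu]_(t in `[0%R, +oo[) ((gsn s t)%:E + (f t)%:E))%E.
  by apply: eq_integral => t _; rewrite -!EFinD; congr _%:E; rewrite /f; ring.
rewrite ge0_integralD//=; last 4 first.
- by move=> t _; rewrite lee_fin st2_ge0.
- exact: mE.
- by move=> t _; rewrite lee_fin mulr_ge0 ?expR_ge0.
- exact: mE.
rewrite ge0_integralD//=; last 4 first.
- by move=> t _; rewrite lee_fin expR_ge0.
- exact: mE.
- by move=> t; rewrite in_itv/= andbT lee_fin; exact: f0.
- exact: mE.
rewrite integral_decay// If => /(congr1 (fun x => x - C%:E)%E).
by rewrite !addeK.
Qed.

Let second_moment s : 0 < s ->
  (\int[mu]_t (t ^+ 2 * gsn s t)%:E = (Num.sqrt (2 * pi / s) / s)%:E)%E.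
Proof.
move=> s0.
have cg := @continuous_gsn s.
have c2 : continuous (fun t : R => t ^+ 2 * gsn s t).
  by move=> x; apply: cvgM; [exact: exprn_continuous|exact: cg].
have c2s : continuous (fun t : R => s * t ^+ 2 * gsn s t).
  move=> x; apply: cvgM; last exact: cg.
  by apply: cvgM; [exact: cvg_cst|exact: exprn_continuous].
have gN t : gsn s (- t) = gsn s t by rewrite /gsn sqrrN.
have E : (s%:E * \int[mu]_t (t ^+ 2 * gsn s t)%:E = \int[mu]_t (gsn s t)%:E)%E.
  rewrite -ge0_integralZl//=; last 3 first.
  - exact: mE.
  - by move=> t _; rewrite lee_fin mulr_ge0 ?expR_ge0 ?sqr_ge0.
  - by rewrite lee_fin ltW.
  under eq_integral do rewrite -EFinM mulrA.
  rewrite !ge0_integral_fold//=; last 2 first.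
  - by move=> t; exact: expR_ge0.
  - by move=> t; exact: st2_ge0.
  under eq_integral do rewrite gN sqrrN EFinD.
  under [RHS]eq_integral do rewrite gN EFinD.
  rewrite !ge0_integralD//= ?half_second_moment//.
  - by move=> t _; rewrite lee_fin expR_ge0.
  - exact: mE.
  - by move=> t _; rewrite lee_fin expR_ge0.
  - exact: mE.
  - by move=> t _; rewrite lee_fin st2_ge0.
  - exact: mE.
  - by move=> t _; rewrite lee_fin st2_ge0.
  - exact: mE.
move: E; rewrite integral_gsn//.
move: (integral _ _ _) => [r||] /=; last 2 first.
- by rewrite gt0_muley// lte_fin.
- by rewrite gt0_muleNy// lte_fin.
by rewrite -EFinM => -[<-]; congr (_%:E); field; rewrite gt_eqF.
Qed.

(** The cross term [2 * t * gsn s t] is odd and disappears on folding. *)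
Let shifted_second_moment s : 0 < s ->
  (\int[mu]_t ((t + 1) ^+ 2 * gsn s t)%:E = (Num.sqrt (2 * pi / s) * (s^-1 + 1))%:E)%E.
Proof.
move=> s0.
have cg := @continuous_gsn s.
have c2 : continuous (fun t : R => t ^+ 2 * gsn s t).
  by move=> x; apply: cvgM; [exact: exprn_continuous|exact: cg].
have c1 : continuous (fun t : R => (t + 1) ^+ 2 * gsn s t).
  move=> x; apply: cvgM; last exact: cg.
  apply: (@continuous_comp _ _ _ (fun t => t + 1) (fun t => t ^+ 2)); last exact: exprn_continuous.
  by apply: cvgD; [exact: cvg_id|exact: cvg_cst].
have gN t : gsn s (- t) = gsn s t by rewrite /gsn sqrrN.
transitivity (\int[mu]_t (t ^+ 2 * gsn s t + gsn s t)%:E)%E.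
  rewrite !ge0_integral_fold//=.
  - by apply: eq_integral => t _; rewrite !gN; congr _%:E; ring.
  - by move=> t; rewrite addr_ge0 ?expR_ge0// mulr_ge0 ?expR_ge0 ?sqr_ge0.
  - by move=> x; apply: cvgD; [exact: c2|exact: cg].
  - by move=> t; rewrite mulr_ge0 ?expR_ge0 ?sqr_ge0.
under eq_integral do rewrite EFinD.
rewrite ge0_integralD//=; last 4 first.
- by move=> t _; rewrite lee_fin mulr_ge0 ?expR_ge0 ?sqr_ge0.
- exact: mE.
- by move=> t _; rewrite lee_fin expR_ge0.
- exact: mE.
by rewrite second_moment// integral_gsn// -EFinD; congr _%:E; ring.
Qed.

(* The linear term is recovered from squares, [2 u = (u + 1)^2 - u^2 - 1], so that only
   nonnegative integrands need to be evaluated. *)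
Lemma integral_gsn_quadratic s m (q l c : R) : 0 < s ->
  (\int[mu]_t (gsn s (t - m) * (q * (t - m) ^+ 2 + l * (t - m) + c))%:E =
   (Num.sqrt (2 * pi / s) * (q / s + c))%:E)%E.
Proof.
move=> s0.
have cg := @continuous_gsn s.
have c2 : continuous (fun t : R => t ^+ 2 * gsn s t).
  by move=> x; apply: cvgM; [exact: exprn_continuous|exact: cg].
have c1 : continuous (fun t : R => (t + 1) ^+ 2 * gsn s t).
  move=> x; apply: cvgM; last exact: cg.
  apply: (@continuous_comp _ _ _ (fun t => t + 1) (fun t => t ^+ 2)); last exact: exprn_continuous.
  by apply: cvgD; [exact: cvg_id|exact: cvg_cst].
have cc (f : R -> R) : continuous f -> continuous (fun t => f (t - m)).
  move=> cf x; apply: (@continuous_comp _ _ _ (fun t => t - m) f); last exact: cf.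
  by apply: cvgB; [exact: cvg_id|exact: cvg_cst].
(* A finite value for a nonnegative integrand also yields integrability, which linearity of the
   integral requires below. *)
have int (f : R -> R) r : (forall t, 0 <= f t) -> continuous f ->
    (\int[mu]_t (f t)%:E = r%:E)%E ->
    (\int[mu]_t (f (t - m))%:E = r%:E)%E /\
    mu.-integrable setT (fun t => (f (t - m))%:E).
  move=> f0 cf fr; have E := fr; rewrite -(ge0_integral_center m f0 cf) in E; split=> //.
  apply/integrableP; split.
    by apply: (@mE setT (fun t => f (t - m))); exact: cc.
  by under eq_integral do rewrite gee0_abs ?lee_fin ?f0//; rewrite E ltry.
have [E0 I0] := int _ _ (fun t => expR_ge0 _) cg (integral_gsn s0).
have [|E2 I2] := int _ _ _ c2 (second_moment s0).
  by move=> t; rewrite mulr_ge0 ?expR_ge0 ?sqr_ge0.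
have [|E1 I1] := int _ _ _ c1 (shifted_second_moment s0).
  by move=> t; rewrite mulr_ge0 ?expR_ge0 ?sqr_ge0.
transitivity (\int[mu]_t (((q - l / 2)%:E * ((t - m) ^+ 2 * gsn s (t - m))%:E +
   (l / 2)%:E * ((t - m + 1) ^+ 2 * gsn s (t - m))%:E) + (c - l / 2)%:E * (gsn s (t - m))%:E))%E.
  by apply: eq_integral => t _; rewrite -!EFinM -!EFinD; congr _%:E; field.
rewrite integralD//=; last 2 first.
- by apply: integrableD => //; apply: integrableZl.
- by apply: integrableZl.
rewrite integralD//=; last 2 first.
- by apply: integrableZl.
- by apply: integrableZl.
rewrite !integralZl// E0 E1 E2 -!EFinM -!EFinD; congr _%:E.
by field; rewrite gt_eqF.
Qed.

End OneDim.

(** * Positive definite matrices *)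

Section PosDef.
Variable R : realFieldType.

(** Symmetry is included because, over the reals, positivity of the quadratic form does not imply
    it. *)
Definition posdefmx n (A : 'M[R]_n) :=
  A^T = A /\ forall x : 'cV_n, x != 0 -> 0 < (x^T *m A *m x) 0 0.

Lemma posdefmx_ge0 n (A : 'M[R]_n) (x : 'cV_n) :
  posdefmx A -> 0 <= (x^T *m A *m x) 0 0.
Proof.
move=> [_ A0]; have [->|x0] := eqVneq x 0; first by rewrite mulmx0 mxE.
exact/ltW/A0.
Qed.

(** A nonzero kernel vector would make the quadratic form vanish. *)
Lemma posdefmx_unit n (A : 'M[R]_n) : posdefmx A -> A \in unitmx.
Proof.
move=> [_ A0]; rewrite -row_free_unit -kermx_eq0; apply/eqP/row_matrixP => i.
rewrite row0; apply/eqP/negPn/negP => v0.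
have := A0 (row i (kermx A))^T; rewrite trmx_eq0 trmxK => /(_ v0).
by rewrite -row_mul mulmx_ker row0 mul0mx mxE ltxx.
Qed.

Lemma posdefmx_inv n (A : 'M[R]_n) : posdefmx A -> posdefmx (invmx A).
Proof.
move=> pA; have uA := posdefmx_unit pA; case: (pA) => symA A0; split.
  by rewrite trmx_inv symA.
move=> x x0; have := A0 (invmx A *m x).
rewrite trmx_mul trmx_inv symA mulmxKV// mulmxA; apply.
by apply: contra x0 => /eqP/(congr1 (mulmx A)); rewrite mulmx0 mulKVmx// => ->.
Qed.

Lemma sqnorm_mxE n (x : 'cV[R]_n) : (x^T *m x) 0 0 = \sum_i x i 0 ^+ 2.
Proof. by rewrite mxE; apply: eq_bigr => i _; rewrite mxE expr2. Qed.

Lemma sqnorm_gt0 n (x : 'cV[R]_n) : x != 0 -> 0 < (x^T *m x) 0 0.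
Proof.
move=> x0; rewrite sqnorm_mxE lt0r sumr_ge0 ?andbT; last by move=> i _; exact: sqr_ge0.
apply: contra x0; rewrite psumr_eq0 => [/allP h|i _]; last exact: sqr_ge0.
apply/eqP/matrixP => i j; rewrite ord1 [RHS]mxE.
by have := h i (mem_index_enum _); rewrite /= sqrf_eq0 => /eqP.
Qed.

Lemma posdefmx_scalar n (a : R) : 0 < a -> posdefmx (a%:M : 'M[R]_n).
Proof.
move=> a0; split=> [|x x0]; first by rewrite tr_scalar_mx.
by rewrite mul_mx_scalar -scalemxAl mxE mulr_gt0// sqnorm_gt0.
Qed.

(** Serves both for the output covariance and, with the transposed channel matrix, for the inverse
    covariance of the input given the output. *)
Lemma posdefmx_addcongr m n (A : 'M[R]_m) (S : 'M[R]_n) (W : 'M[R]_(m, n)) :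
  posdefmx A -> posdefmx S -> posdefmx (A + W *m S *m W^T).
Proof.
move=> [symA A0] pS; split=> [|x x0].
  by rewrite raddfD/= !trmx_mul trmxK symA pS.1 mulmxA.
rewrite mulmxDr mulmxDl mxE ltr_pwDl ?A0//.
by have := posdefmx_ge0 (W^T *m x) pS; rewrite trmx_mul trmxK !mulmxA.
Qed.

(** The unipotent factor of one elimination step: a vector with head [u] keeps its head and has
    [u *: k] added to its tail. *)
Definition shearmx n (k : 'cV[R]_n) : 'M[R]_(1 + n) := block_mx 1%:M 0 k 1%:M.

Lemma shearmxNK n (k : 'cV[R]_n) : shearmx (- k) *m shearmx k = 1%:M.
Proof.
rewrite mulmx_block !(mul1mx, mulmx1, mul0mx, mulmx0, addr0, add0r) addNr.
by rewrite -scalar_mx_block.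
Qed.

Lemma det_shearmx n (k : 'cV[R]_n) : \det (shearmx k) = 1.
Proof. by rewrite det_lblock !det1 mulr1. Qed.

(* One step of the LDL^T decomposition, [s] being the Schur complement. *)
Lemma posdefmx_shear n (A : 'M[R]_(1 + n)) : posdefmx A ->
  exists s (k : 'cV_n) (B : 'M[R]_n), [/\ 0 < s, posdefmx B &
    A = (shearmx k)^T *m block_mx s%:M 0 0 B *m shearmx k].
Proof.
move=> [symA A0]; pose B := drsubmx A; pose r := dlsubmx A.
have symB : B^T = B by rewrite trmx_drsub symA.
have rE : ursubmx A = r^T by rewrite trmx_dlsub symA.
have AE : A = block_mx (ulsubmx A) r^T r B by rewrite -rE submxK.
have pB : posdefmx B.
  split=> // x x0; have := A0 (col_mx 0 x).
  rewrite col_mx_eq0 eqxx/= => /(_ x0).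
  rewrite AE tr_col_mx mul_row_block mul_row_col.
  by rewrite trmx0 !mul0mx !mulmx0 !add0r.
have uB := posdefmx_unit pB.
(* Solving [B *m k = r] is what lets the shear clear the off-diagonal blocks. *)
have [k Bk] : exists k, B *m k = r by exists (invmx B *m r); rewrite mulKVmx.
have kB : k^T *m B = r^T by rewrite -Bk trmx_mul symB.
pose s := (ulsubmx A - k^T *m B *m k) 0 0.
have sE : s%:M + k^T *m B *m k = ulsubmx A.
  by rewrite -mx11_scalar subrK.
have AE2 : A = (shearmx k)^T *m block_mx s%:M 0 0 B *m shearmx k.
  rewrite tr_block_mx !trmx1 trmx0 mulmx_block.
  rewrite !(mul1mx, mulmx1, mul0mx, mulmx0, addr0, add0r) mulmx_block.
  by rewrite !(mul1mx, mulmx1, mul0mx, mulmx0, addr0, add0r) sE kB Bk.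
exists s, k, B; split=> //.
(* The preimage of the first basis vector under the shear is nonzero and the form of [A] takes the
   value [s] on it, so [s] is positive. *)
have := A0 (shearmx (- k) *m col_mx 1%:M 0).
have -> : (shearmx (- k) *m col_mx 1%:M 0)^T *m A *m (shearmx (- k) *m col_mx 1%:M 0) = s%:M.
  have kK : shearmx k *m shearmx (- k) = 1%:M by apply: mulmx1C; exact: shearmxNK.
  have kTK : (shearmx (- k))^T *m (shearmx k)^T = 1%:M by rewrite -trmx_mul kK trmx1.
  rewrite AE2 trmx_mul !mulmxA -[_ *m _ *m (shearmx k)^T]mulmxA kTK mulmx1.
  rewrite -[_ *m _ *m shearmx (- k)]mulmxA kK mulmx1.
  rewrite tr_col_mx trmx1 trmx0 mul_row_block mul_row_col.
  by rewrite !(mul1mx, mulmx1, mul0mx, mulmx0, addr0, add0r).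
rewrite mxE; apply.
apply/eqP => /(congr1 (mulmx (shearmx (- - k)))).
rewrite mulmxA shearmxNK mul1mx mulmx0 => /eqP; rewrite col_mx_eq0 => /andP[/eqP].
by move/matrixP/(_ 0 0)/eqP; rewrite !mxE oner_eq0.
Qed.

(** Induction on the dimension by shearing: the determinant is [s * \det B], the trailing diagonal
    is that of [B], and the leading entry [s + k^T B k] is at least [s]. *)
Lemma det_posdefmx_hadamard n (A : 'M[R]_n) :
  posdefmx A -> 0 < \det A <= \prod_i A i i.
Proof.
elim: n A => [A _|n IHn A]; first by rewrite det_mx00 big_ord0 ltr01 lexx.
suff H (M : 'M[R]_(1 + n)) : posdefmx M -> 0 < \det M <= \prod_i M i i by exact: H.
move=> /posdefmx_shear [s [k [B [s0 pB ->]]]].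
have /andP[dB BH] := IHn B pB.
rewrite !det_mulmx det_tr det_shearmx mul1r mulr1 det_ublock det_scalar1.
rewrite mulr_gt0//=.
rewrite tr_block_mx !trmx1 trmx0 mulmx_block.
rewrite !(mul1mx, mulmx1, mul0mx, mulmx0, addr0, add0r) mulmx_block.
rewrite !(mul1mx, mulmx1, mul0mx, mulmx0, addr0, add0r).
rewrite big_split_ord big_ord1 block_mxEul.
under eq_bigr do rewrite block_mxEdr.
apply: ler_pM => //; [exact: ltW|exact: ltW|].
by rewrite mxE mxE eqxx mulr1n lerDl posdefmx_ge0.
Qed.

Lemma det_posdefmx_gt0 n (A : 'M[R]_n) : posdefmx A -> 0 < \det A.
Proof. by move/det_posdefmx_hadamard/andP => -[]. Qed.

End PosDef.

(** Sylvester's identity: with [N] unipotent, [N *m M] and [M *m N] have the same determinant, and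
    each is block triangular. *)
Lemma det_addmulmxC (R : comNzRingType) m n (A : 'M[R]_(m, n)) (B : 'M[R]_(n, m)) :
  \det (1%:M + A *m B) = \det (1%:M + B *m A).
Proof.
pose M := block_mx 1%:M A (- B) 1%:M; pose N : 'M[R]_(m + n) := block_mx 1%:M (- A) 0 1%:M.
have dN : \det N = 1 by rewrite det_ublock !det1 mulr1.
have <- : \det (N *m M) = \det (1%:M + A *m B).
  rewrite mulmx_block !(mul1mx, mulmx1, mul0mx, mulmx0, addr0, add0r) subrr.
  by rewrite det_lblock det1 mulr1 mulNmx mulmxN opprK.
have <- : \det (M *m N) = \det (1%:M + B *m A).
  rewrite mulmx_block !(mul1mx, mulmx1, mul0mx, mulmx0, addr0, add0r) addNr.
  by rewrite det_lblock det1 mul1r mulNmx mulmxN opprK addrC.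
by rewrite !det_mulmx dN mul1r mulr1.
Qed.

(** * Gaussian integrals in several variables *)

Section MultiDim.
Variable R : realType.
Notation mu := (@lebesgue_measure R).

Lemma eq_iint n (f g : seq R -> \bar R) : f =1 g -> iint n f = iint n g.
Proof. by move=> fg; congr iint; apply/funext. Qed.

Lemma eq_int_Rn n (f g : 'cV[R]_n -> \bar R) : f =1 g -> int_Rn f = int_Rn g.
Proof. by move=> fg; congr int_Rn; apply/funext. Qed.

Lemma int_RnS n (f : 'cV[R]_(1 + n) -> \bar R) :
  int_Rn f = (\int[mu]_t int_Rn (fun y => f (col_mx t%:M y)))%E.
Proof.
apply: eq_integral => t _; apply: eq_iint => s; congr f.
apply/matrixP => i j; rewrite !ord1 !mxE; case: splitP => [k|k] /= ik.
  by rewrite ord1 in ik *; rewrite ik mxE.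
by rewrite ik mxE.
Qed.

Lemma quad_block n (a : R) (b : 'rV_n) (c : 'cV_n) (Q : 'M[R]_n) u (w : 'cV_n) :
  ((col_mx u%:M w)^T *m block_mx a%:M b c Q *m col_mx u%:M w) 0 0 =
  a * u ^+ 2 + u * ((b + c^T) *m w) 0 0 + (w^T *m Q *m w) 0 0.
Proof.
rewrite tr_col_mx tr_scalar_mx mul_row_block mul_row_col !mulmxDl.
rewrite -!scalar_mxM !mul_scalar_mx !mul_mx_scalar -scalemxAl.
have -> : w^T *m c = c^T *m w.
  by rewrite -[LHS]trmxK trmx_mul trmxK; apply/matrixP => i j; rewrite !ord1 mxE.
rewrite !mxE /= mulr1n; ring.
Qed.

Lemma shearmx_col n (k : 'cV[R]_n) u (w : 'cV_n) :
  shearmx k *m col_mx u%:M w = col_mx u%:M (w + u *: k).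
Proof.
by rewrite mul_block_col !mul1mx mul0mx addr0 mul_mx_scalar addrC.
Qed.

(** The matrix [A] is an inverse covariance. Integrating the tail first leaves a one-dimensional
    Gaussian times a quadratic polynomial in the first coordinate; an arbitrary quadratic, linear
    and constant part is allowed so that the induction is closed under this step. *)
Lemma int_Rn_gauss n (A : 'M[R]_n) (m : 'cV[R]_n) (Q : 'M[R]_n) (l : 'rV[R]_n) (c : R) :
  posdefmx A ->
  int_Rn (fun x => (expR (- (1 / 2) * ((x - m)^T *m A *m (x - m)) 0 0) *
    (((x - m)^T *m Q *m (x - m)) 0 0 + (l *m (x - m)) 0 0 + c))%:E) =
  (Num.sqrt ((2 * pi) ^+ n / \det A) * (\tr (Q *m invmx A) + c))%:E.
Proof.
elim: n A m Q l c => [|n IHn].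
  move=> A m Q l c _; rewrite /int_Rn /= /mxtrace big_ord0 det_mx00 expr0 divr1 sqrtr1.
  by rewrite [_ - m]flatmx0 !mulmx0 !mxE mulr0 expR0 addr0.
(* The dimension is rewritten as [1 + n], convertible to [n.+1], to make block matrices
   available. *)
suff H (A : 'M[R]_(1 + n)) (m : 'cV[R]_(1 + n)) (Q : 'M[R]_(1 + n)) (l : 'rV[R]_(1 + n)) (c : R) :
  posdefmx A ->
  int_Rn (fun x => (expR (- (1 / 2) * ((x - m)^T *m A *m (x - m)) 0 0) *
    (((x - m)^T *m Q *m (x - m)) 0 0 + (l *m (x - m)) 0 0 + c))%:E) =
  (Num.sqrt ((2 * pi) ^+ n.+1 / \det A) * (\tr (Q *m invmx A) + c))%:E by exact: H.
move=> /[dup] /posdefmx_unit uA /posdefmx_shear [s [k [B [s0 pB AE]]]].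
pose D := block_mx (s%:M : 'M[R]_1) 0 0 B.
pose L := shearmx k; pose L' := shearmx (- k).
have L'L : L' *m L = 1%:M by exact: shearmxNK.
have LL' : L *m L' = 1%:M by exact: mulmx1C.
(* Coefficients of the polynomial in the sheared coordinates [L *m v], where [A] becomes the block
   diagonal [D]. *)
pose Q' := L'^T *m Q *m L'; pose l' := l *m L'.
have QE v : (v^T *m Q *m v) 0 0 = ((L *m v)^T *m Q' *m (L *m v)) 0 0.
  rewrite /Q' trmx_mul !mulmxA -[_ *m L^T *m L'^T]mulmxA -trmx_mul L'L trmx1 mulmx1.
  by rewrite -[_ *m L' *m L]mulmxA L'L mulmx1.
have AvE v : (v^T *m A *m v) 0 0 = ((L *m v)^T *m D *m (L *m v)) 0 0.
  by rewrite AE trmx_mul !mulmxA.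
have lE v : (l *m v) 0 0 = (l' *m (L *m v)) 0 0.
  by rewrite /l' !mulmxA -[_ *m L' *m L]mulmxA L'L mulmx1.
pose q1 := ulsubmx Q' 0 0; pose q2 := ursubmx Q'; pose q3 := dlsubmx Q'; pose q4 := drsubmx Q'.
have Q'E : Q' = block_mx q1%:M q2 q3 q4 by rewrite -mx11_scalar submxK.
pose l1 := lsubmx l' 0 0; pose l2 := rsubmx l'.
have l'E : l' = row_mx l1%:M l2 by rewrite -mx11_scalar hsubmxK.
pose m0 := usubmx m 0 0; pose m' := dsubmx m.
have mE : m = col_mx m0%:M m' by rewrite -mx11_scalar vsubmxK.
have detA : \det A = s * \det B.
  by rewrite AE !det_mulmx det_tr det_shearmx mul1r mulr1 det_ublock det_scalar1.
have trE : \tr (Q *m invmx A) = q1 / s + \tr (q4 *m invmx B).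
  have uB := posdefmx_unit pB.
  (* The inverse is [L' *m invmx D *m L'^T], so cyclicity of the trace brings out [Q'], of which
     only the diagonal blocks count. *)
  have -> : invmx A = L' *m block_mx (s^-1)%:M 0 0 (invmx B) *m L'^T.
    set X := RHS; suff AX : A *m X = 1%:M.
      by rewrite -[X]mul1mx -(mulVmx uA) -mulmxA AX mulmx1.
    rewrite /X AE !mulmxA -/L -/D -[_ *m L *m L']mulmxA LL' mulmx1 -[_ *m D *m _]mulmxA.
    rewrite /D mulmx_block !(mulmx0, mul0mx, addr0, add0r) mulmxV// -scalar_mxM.
    rewrite divff ?gt_eqF// -scalar_mx_block mulmx1 -trmx_mul L'L.
    by rewrite trmx1.
  rewrite !mulmxA mxtrace_mulC !mulmxA -/Q' Q'E mulmx_block mxtrace_block.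
  by rewrite !(mulmx0, mul0mx, addr0, add0r) -scalar_mxM mxtrace_scalar.
rewrite int_RnS.
pose Z := Num.sqrt ((2 * pi) ^+ n / \det B).
(* The tail contributes the factor [Z] and the trace of its own quadratic part; its linear part
   averages to zero. *)
transitivity (\int[mu]_t (gsn s (t - m0) * ((Z * q1) * (t - m0) ^+ 2 + (Z * l1) * (t - m0) +
   Z * (\tr (q4 *m invmx B) + c)))%:E)%E.
  apply: eq_integral => t _; set u := t - m0.
  (* For fixed [t] the tail is centred at [m' - u *: k], and the factor [gsn s u] is a constant that
     is moved into the polynomial. *)
  transitivity (int_Rn (fun y => (expR (- (1 / 2) *
      ((y - (m' - u *: k))^T *m B *m (y - (m' - u *: k))) 0 0) *
     (((y - (m' - u *: k))^T *m (gsn s u *: q4) *m (y - (m' - u *: k))) 0 0 +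
     ((gsn s u *: (u *: (q2 + q3^T) + l2)) *m (y - (m' - u *: k))) 0 0 +
     gsn s u * (q1 * u ^+ 2 + l1 * u + c)))%:E)).
    apply: eq_int_Rn => y; congr _%:E.
    have vE : L *m (col_mx t%:M y - m) = col_mx u%:M (y - (m' - u *: k)).
      rewrite mE opp_col_mx add_col_mx -raddfB/= shearmx_col; congr col_mx.
      by rewrite opprB addrA addrAC.
    have DE w : ((col_mx u%:M w)^T *m D *m col_mx u%:M w) 0 0 =
        s * u ^+ 2 + (w^T *m B *m w) 0 0.
      rewrite quad_block trmx0 addr0 mul0mx; congr (_ + _).
      by rewrite mxE mulr0 addr0.
    rewrite AvE QE lE vE DE Q'E l'E quad_block.
    set w := y - _.
    have Z00 a (M : 'M[R]_1) : (a *: M) 0 0 = a * M 0 0 by rewrite mxE.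
    have D00 (M N : 'M[R]_1) : (M + N) 0 0 = M 0 0 + N 0 0 by rewrite mxE.
    have S00 a : (a%:M : 'M[R]_1) 0 0 = a by rewrite mxE mulr1n.
    rewrite mul_row_col -scalar_mxM -!scalemxAr -!scalemxAl [(u *: _ + _) *m w]mulmxDl -scalemxAl.
    rewrite !(Z00, D00, S00) [- (1 / 2) * (_ + _)]mulrDr expRD -/(gsn s u); ring.
  rewrite IHn// -/Z -scalemxAl mxtraceZ; congr _%:E; ring.
rewrite integral_gsn_quadratic// trE detA; congr _%:E.
have -> : Num.sqrt ((2 * pi) ^+ n.+1 / (s * \det B)) = Num.sqrt (2 * pi / s) * Z.
  rewrite -sqrtrM; last by rewrite divr_ge0 ?mulr_ge0 ?pi_ge0 ?ltW.
  congr Num.sqrt; rewrite exprS; field.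
  by rewrite !gt_eqF// ?det_posdefmx_gt0.
ring.
Qed.

End MultiDim.

(** * Mutual information of the channel *)

Section Information.
Variable R : realType.

Lemma quad_symC n (A : 'M[R]_n) (x y : 'cV_n) :
  A^T = A -> (x^T *m A *m y) 0 0 = (y^T *m A *m x) 0 0.
Proof.
move=> symA; have -> : y^T *m A *m x = (x^T *m A *m y)^T.
  by rewrite !trmx_mul trmxK symA mulmxA.
by rewrite [RHS]mxE.
Qed.

Lemma quad_sub n (A : 'M[R]_n) (x y : 'cV_n) : A^T = A ->
  ((x - y)^T *m A *m (x - y)) 0 0 =
  (x^T *m A *m x) 0 0 - 2 * (y^T *m A *m x) 0 0 + (y^T *m A *m y) 0 0.
Proof.
move=> symA; have := quad_symC x y symA.
have -> : (x - y)^T = x^T - y^T by rewrite linearB.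
rewrite !mulmxBl !mulmxBr.
have D00 (M N : 'M[R]_1) : (M - N) 0 0 = M 0 0 - N 0 0 by rewrite !mxE.
by rewrite !D00 => ->; ring.
Qed.

Definition gauss_norm n (A : 'M[R]_n) : R := Num.sqrt ((2 * pi) ^+ n * \det A).

Lemma gauss_norm_gt0 n (A : 'M[R]_n) : posdefmx A -> 0 < gauss_norm A.
Proof. by move=> pA; rewrite sqrtr_gt0 mulr_gt0 ?det_posdefmx_gt0// exprn_gt0// mulr_gt0// pi_gt0. Qed.

Lemma gauss_norm_inv n (A : 'M[R]_n) :
  Num.sqrt ((2 * pi) ^+ n / \det (invmx A)) = gauss_norm A.
Proof. by rewrite det_inv invrK. Qed.

Lemma gauss_pdf_gt0 n (mu : 'cV[R]_n) A x : posdefmx A -> 0 < gauss_pdf mu A x.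
Proof. by move=> pA; rewrite mulr_gt0 ?expR_gt0// invr_gt0; exact: gauss_norm_gt0. Qed.

Section Channel.
Variables (N0 N1 : nat) (S : 'M[R]_N0) (s2 : R) (W : 'M[R]_(N1, N0)) (b : 'cV[R]_N1).
Hypotheses (pS : posdefmx S) (s20 : 0 < s2).

Let C := s2%:M + W *m S *m W^T.

Lemma posdefmx_out : posdefmx C.
Proof. by apply: posdefmx_addcongr => //; exact: posdefmx_scalar. Qed.

(** The inverse covariance of [X] given [Z]. *)
Let H := invmx S + W^T *m s2^-1%:M *m W.

Let pH : posdefmx H.
Proof.
rewrite /H -{2}[W]trmxK; apply: posdefmx_addcongr; first exact: posdefmx_inv.
by apply: posdefmx_scalar; rewrite invr_gt0.
Qed.

(** Writing [W^T *m W] as [s2 *: (H - invmx S)] turns the product of the two correction terms into a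
    difference that cancels what remains. *)
Let woodbury : invmx C = s2^-1%:M - s2^-1 ^+ 2 *: (W *m invmx H *m W^T).
Proof.
have uS := posdefmx_unit pS; have uH := posdefmx_unit pH.
have uC := posdefmx_unit posdefmx_out.
set X := RHS; suff CX : C *m X = 1%:M.
  by rewrite -[invmx C]mulmx1 -CX mulKmx.
have s20' : s2 != 0 by rewrite gt_eqF.
have SH : W *m S *m (W^T *m (W *m invmx H *m W^T)) =
    s2 *: (W *m S *m W^T - W *m invmx H *m W^T).
  have WWE : W^T *m W = s2 *: (H - invmx S).
    by rewrite /H addrC addKr mul_mx_scalar -scalemxAl scalerA divff// scale1r.
  rewrite !mulmxA -[W *m S *m W^T *m W]mulmxA WWE -!scalemxAr -!scalemxAl; congr (_ *: _).
  rewrite mulmxBr !mulmxBl -[_ *m H *m _]mulmxA mulmxV// mulmx1.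
  by rewrite -[_ *m S *m invmx S]mulmxA mulmxV// mulmx1.
rewrite /X /C mulmxDl !mulmxBr -scalar_mxM divff// mul_mx_scalar.
rewrite mul_scalar_mx -[W *m S *m W^T *m _]mulmxA -!scalemxAr SH !scalerA.
have -> : s2 * s2^-1 ^+ 2 = s2^-1 by field.
have -> : s2^-1 ^+ 2 * s2 = s2^-1 by field.
by rewrite scalerBr opprB [s2^-1 *: (W *m S *m W^T) + _]addrC subrK subrK.
Qed.

(** Sylvester's identity moves the determinant to the input side, where the matrix is [S *m H]. *)
Let det_out : \det C = \det S * \det H * s2 ^+ N1.
Proof.
have uS := posdefmx_unit pS; have s20' : s2 != 0 by rewrite gt_eqF.
have -> : C = s2 *: (1%:M + W *m (s2^-1 *: (S *m W^T))).
  by rewrite scalerDr scalemx1 -scalemxAr scalerA divff// scale1r mulmxA.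
rewrite detZ det_addmulmxC -det_mulmx mulrC; congr (\det _ * _).
by rewrite /H mulmxDr mulmxV// mul_mx_scalar -!scalemxAl -scalemxAr mulmxA.
Qed.

(** The vector [m] is the conditional mean of [X] given [Z - b = d]. *)
Let square_completion (x : 'cV_N0) (d : 'cV_N1) :
  let m := invmx H *m (s2^-1 *: (W^T *m d)) in
  (x^T *m invmx S *m x) 0 0 + ((d - W *m x)^T *m s2^-1%:M *m (d - W *m x)) 0 0 =
  ((x - m)^T *m H *m (x - m)) 0 0 + (d^T *m invmx C *m d) 0 0.
Proof.
move=> m; have uH := posdefmx_unit pH.
have Z00 a (M : 'M[R]_1) : (a *: M) 0 0 = a * M 0 0 by rewrite mxE.
have D00 (M N : 'M[R]_1) : (M + N) 0 0 = M 0 0 + N 0 0 by rewrite mxE.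
have N00 (M : 'M[R]_1) : (- M) 0 0 = - M 0 0 by rewrite mxE.
have mH : m^T *m H = s2^-1 *: (d^T *m W).
  rewrite /m trmx_mul trmx_inv pH.1 mulmxKV// linearZ/= trmx_mul trmxK.
  by [].
have HE : (x^T *m H *m x) 0 0 =
    (x^T *m invmx S *m x) 0 0 + s2^-1 * (x^T *m W^T *m W *m x) 0 0.
  rewrite /H mulmxDr mulmxDl mul_mx_scalar -!scalemxAl -!scalemxAr -!scalemxAl !mulmxA.
  by rewrite D00 Z00.
have dWx : (x^T *m W^T *m d) 0 0 = (d^T *m W *m x) 0 0.
  have -> : d^T *m W *m x = (x^T *m W^T *m d)^T by rewrite !trmx_mul !trmxK mulmxA.
  by rewrite [RHS]mxE.
rewrite quad_sub ?tr_scalar_mx// quad_sub ?pH.1// mH HE.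
rewrite woodbury mulmxBr mulmxBl /m trmx_mul.
rewrite !mul_mx_scalar -!scalemxAl -?scalemxAr -?scalemxAl !mulmxA.
rewrite !(Z00, D00, N00) dWx; ring.
Qed.

(** As a function of [x], the joint density is the constant [K] times an unnormalised Gaussian with
    inverse covariance [H]; [det_out] then matches the normalisations. *)
Lemma pZ_gauss z : pZ S s2 W b z = gauss_pdf b C z.
Proof.
have pC := posdefmx_out.
have pN : posdefmx (s2%:M : 'M[R]_N1) by exact: posdefmx_scalar.
pose d := z - b; pose m := invmx H *m (s2^-1 *: (W^T *m d)).
pose K := (gauss_norm S)^-1 * (gauss_norm (s2%:M : 'M[R]_N1))^-1 *
  expR (- (1 / 2) * (d^T *m invmx C *m d) 0 0).
rewrite /pZ; transitivity (fine (int_Rn (fun x : 'cV[R]_N0 =>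
    (expR (- (1 / 2) * ((x - m)^T *m H *m (x - m)) 0 0) *
    (((x - m)^T *m (0 : 'M[R]_N0) *m (x - m)) 0 0 + ((0 : 'rV[R]_N0) *m (x - m)) 0 0 + K))%:E))).
  congr fine; apply: eq_int_Rn => x; congr _%:E.
  rewrite /pXZ /pX /pZgX /gauss_pdf -/(gauss_norm S) -/(gauss_norm _) subr0 invmx_scalar.
  have -> : z - (W *m x + b) = d - W *m x by rewrite opprD addrCA addrC.
  rewrite mulmx0 !mul0mx [(0 : 'M[R]_1) _ _]mxE !add0r.
  have := square_completion x d; rewrite /= -/m /K.
  set q1 := (_ *m invmx S *m _) 0 0; set q2 := (_ *m s2^-1%:M *m _) 0 0.
  set q3 := (_ *m H *m _) 0 0; set q4 := (_ *m invmx C *m _) 0 0 => qE.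
  have eE : expR (- (1 / 2) * q1) * expR (- (1 / 2) * q2) =
      expR (- (1 / 2) * q3) * expR (- (1 / 2) * q4).
    by rewrite -!expRD -!mulrDr qE.
  by rewrite mulrACA eE; ring.
rewrite int_Rn_gauss//= mul0mx mxtrace0 add0r /gauss_pdf -/(gauss_norm C) -/d /K mulrA.
congr (_ * _).
rewrite /gauss_norm det_out det_scalar.
have dS := det_posdefmx_gt0 pS; have dH := det_posdefmx_gt0 pH.
have p0 n : 0 < (2 * pi : R) ^+ n by rewrite exprn_gt0// mulr_gt0// pi_gt0.
have s0 n : 0 < s2 ^+ n by rewrite exprn_gt0.
rewrite -!sqrtrV -?sqrtrM ?invr_ge0 ?divr_ge0 ?mulr_ge0 ?ltW ?mulr_gt0//.
congr Num.sqrt; field.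
by rewrite !gt_eqF.
Qed.

(** The log-ratio is [c0] plus half the output form at [z - b] minus half the noise form at
    [z - (W *m x + b)]. Both forms have mean [N1], so only [c0] survives. *)
Lemma MI_capacity : MI S s2 W b = (1 / 2 * ln (\det C / s2 ^+ N1))%:E.
Proof.
have pC := posdefmx_out.
have s20' : s2 != 0 by rewrite gt_eqF.
have pN : posdefmx (s2%:M : 'M[R]_N1) by exact: posdefmx_scalar.
have pV : posdefmx (s2^-1%:M : 'M[R]_N1) by apply: posdefmx_scalar; rewrite invr_gt0.
have gC := gauss_norm_gt0 pC; have gN := gauss_norm_gt0 pN; have gS := gauss_norm_gt0 pS.
pose c0 := ln (gauss_norm C / gauss_norm (s2%:M : 'M[R]_N1)).
have c0E : c0 = 1 / 2 * ln (\det C / s2 ^+ N1).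
  have p0 : 0 < (2 * pi : R) ^+ N1 by rewrite exprn_gt0// mulr_gt0// pi_gt0.
  have s0 : 0 < s2 ^+ N1 by rewrite exprn_gt0.
  have dC := det_posdefmx_gt0 pC.
  have -> : \det C / s2 ^+ N1 = (gauss_norm C / gauss_norm (s2%:M : 'M[R]_N1)) ^+ 2.
    rewrite exprMn exprVn !sqr_sqrtr ?mulr_ge0 ?det_scalar ?ltW//; field.
    by rewrite !gt_eqF.
  by rewrite lnXn ?divr_gt0// -/c0 -mulr_natl; field.
(* What averaging over the noise leaves: it adds [s2 * \tr (invmx C)] to the output form, and the
   noise form itself has mean [N1]. *)
pose t := 1 / 2 * (s2 * \tr (invmx C) - N1%:R).
pose qx (x : 'cV[R]_N0) := ((W *m x)^T *m invmx C *m (W *m x)) 0 0.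
have D00 (M N : 'M[R]_1) : (M + N) 0 0 = M 0 0 + N 0 0 by rewrite mxE.
have Z00 a (M : 'M[R]_1) : (a *: M) 0 0 = a * M 0 0 by rewrite mxE.
have N00 (M : 'M[R]_1) : (- M) 0 0 = - M 0 0 by rewrite mxE.
have inner x : int_Rn (fun z => (pXZ S s2 W b x z *
    ln (pXZ S s2 W b x z / (pX S x * pZ S s2 W b z)))%:E) =
    (pX S x * (c0 + 1 / 2 * qx x + t))%:E.
  pose K := pX S x / gauss_norm (s2%:M : 'M[R]_N1).
  pose m := W *m x + b.
  transitivity (int_Rn (fun z : 'cV[R]_N1 =>
      (expR (- (1 / 2) * ((z - m)^T *m s2^-1%:M *m (z - m)) 0 0) *
      (((z - m)^T *m (K *: (1 / 2 *: invmx C - 1 / 2 *: s2^-1%:M)) *m (z - m)) 0 0 +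
       ((K *: ((W *m x)^T *m invmx C)) *m (z - m)) 0 0 +
       K * (c0 + 1 / 2 * qx x)))%:E)).
    apply: eq_int_Rn => z; congr _%:E.
    have pX0 : 0 < pX S x by exact: gauss_pdf_gt0.
    (* The input density cancels inside the logarithm. *)
    rewrite /pXZ -mulf_div divff ?gt_eqF// mul1r pZ_gauss /pZgX.
    rewrite /gauss_pdf -/m -/(gauss_norm (s2%:M : 'M[R]_N1)) -/(gauss_norm C) invmx_scalar.
    set w := z - m; have -> : z - b = w - (- (W *m x)).
      by rewrite opprK /w /m opprD addrA addrAC subrK.
    rewrite (quad_sub w (- (W *m x)) (posdefmx_inv pC).1).
    have NT : (- (W *m x))^T = - (W *m x)^T by rewrite linearN.
    clearbody w.
    have -> : ((- (W *m x))^T *m invmx C *m - (W *m x)) 0 0 = qx x.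
      by rewrite NT !mulNmx mulmxN opprK.
    have -> : ((- (W *m x))^T *m invmx C *m w) 0 0 = - ((W *m x)^T *m invmx C *m w) 0 0.
      by rewrite NT !mulNmx N00.
    rewrite -!scalemxAr -!scalemxAl mulmxBr mulmxBl -!scalemxAr -!scalemxAl.
    rewrite !(Z00, D00, N00).
    set q1 := (w^T *m s2^-1%:M *m w) 0 0; set q2 := (w^T *m invmx C *m w) 0 0.
    set q3 := ((W *m x)^T *m invmx C *m w) 0 0.
    have lnE : ln ((gauss_norm (s2%:M : 'M[R]_N1))^-1 * expR (- (1 / 2) * q1) /
        ((gauss_norm C)^-1 * expR (- (1 / 2) * (q2 - 2 * - q3 + qx x)))) =
        c0 - 1 / 2 * q1 + 1 / 2 * (q2 + 2 * q3 + qx x).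
      rewrite invfM invrK -expRN mulrACA -expRD lnM ?posrE ?expR_gt0 ?expRK//; last first.
        by rewrite mulr_gt0 ?invr_gt0.
      rewrite [_^-1 * _]mulrC -/c0; ring.
    rewrite lnE /K; field.
    by rewrite gt_eqF.
  rewrite int_Rn_gauss//; congr _%:E.
  have := gauss_norm_inv (s2%:M : 'M[R]_N1); rewrite invmx_scalar => ->.
  rewrite invmx_scalar invrK.
  rewrite mul_mx_scalar !mxtraceZ linearB/= !mxtraceZ mxtrace_scalar.
  rewrite -mulr_natr /K /t; field.
  by rewrite s20' gt_eqF.
rewrite /MI; transitivity (int_Rn (fun x : 'cV[R]_N0 =>
   (expR (- (1 / 2) * ((x - 0)^T *m invmx S *m (x - 0)) 0 0) *
   (((x - 0)^T *m ((gauss_norm S)^-1 *: (1 / 2 *: (W^T *m invmx C *m W))) *m (x - 0)) 0 0 +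
    ((0 : 'rV[R]_N0) *m (x - 0)) 0 0 + (gauss_norm S)^-1 * (c0 + t)))%:E)).
  apply: eq_int_Rn => x; rewrite inner; congr _%:E.
  rewrite /pX /gauss_pdf -/(gauss_norm S) !subr0 mul0mx [(0 : 'M[R]_1) _ _]mxE addr0.
  rewrite -!scalemxAr -!scalemxAl !Z00 /qx trmx_mul !mulmxA; ring.
rewrite (int_Rn_gauss _ _ _ _ (posdefmx_inv pS)) gauss_norm_inv; congr _%:E.
(* Trace of [invmx C *m C]; it makes the mean of [1 / 2 * qx x] cancel [t]. *)
have trC : \tr (W^T *m invmx C *m W *m S) + s2 * \tr (invmx C) = N1%:R.
  rewrite -mxtrace1 -(mulVmx (posdefmx_unit pC)) {2}/C mulmxDr mxtraceD mul_mx_scalar mxtraceZ.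
  by rewrite addrC -!mulmxA mxtrace_mulC !mulmxA.
have -> : invmx (invmx S) = S by exact: invmxK.
rewrite -!scalemxAl !mxtraceZ -c0E /t -trC; field.
by rewrite gt_eqF.
Qed.

End Channel.
End Information.

(** * Spectral theorem for real symmetric matrices *)

(** Unless [v] is already the first basis vector [e], take the reflection in the hyperplane
    orthogonal to [v - e]; it exchanges the two unit vectors. *)
Lemma householder (R : realFieldType) n (v : 'cV[R]_(1 + n)) : (v^T *m v) 0 0 = 1 ->
  exists H : 'M[R]_(1 + n), [/\ H^T = H, H *m H = 1%:M & H *m col_mx 1%:M 0 = v].
Proof.
move=> v1; pose e : 'cV[R]_(1 + n) := col_mx 1%:M 0.
have [->|ve] := eqVneq v e; first by exists 1%:M; rewrite trmx1 !mul1mx.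
have ee : e^T *m e = 1%:M.
  by rewrite tr_col_mx mul_row_col trmx1 trmx0 mul1mx mul0mx addr0.
have vv : v^T *m v = 1%:M by rewrite [LHS]mx11_scalar v1.
pose a := (v^T *m e) 0 0.
have vE : v^T *m e = a%:M by rewrite [LHS]mx11_scalar.
have ev : e^T *m v = a%:M by rewrite -[LHS]trmxK trmx_mul trmxK vE tr_scalar_mx.
pose u := v - e; pose q := (u^T *m u) 0 0.
have uT : u^T = v^T - e^T by rewrite linearB.
have q0 : q != 0 by rewrite gt_eqF// sqnorm_gt0// subr_eq0.
have uu : u^T *m u = q%:M by rewrite [LHS]mx11_scalar.
have qE : q = 2 - 2 * a.
  by rewrite /q uT mulmxBl !mulmxBr vv ee vE ev !mxE /= !mulr1n; ring.
exists (1%:M - (2 / q) *: (u *m u^T)); split.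
- by rewrite raddfB/= trmx1 linearZ/= trmx_mul trmxK.
- rewrite mulmxBl mul1mx mulmxBr mulmx1 -scalemxAl -scalemxAr mulmxA.
  rewrite -[u *m u^T *m u]mulmxA uu mul_mx_scalar -scalemxAl !scalerA.
  have -> : 2 / q * (2 / q * q) = 2 / q + 2 / q by field.
  by rewrite scalerDl; set X := _ *: _; rewrite opprB addrK subrK.
- rewrite -/e mulmxBl mul1mx -scalemxAl -mulmxA.
  have -> : u^T *m e = (a - 1)%:M by rewrite uT mulmxBl vE ee raddfB.
  rewrite mul_mx_scalar scalerA.
  have aE : a = 1 - q / 2 by rewrite qE; field.
  have -> : 2 / q * (a - 1) = -1 by rewrite aE; field.
  by rewrite scaleN1r opprK /u addrC subrK.
Qed.

Lemma char_poly_conj (R : comNzRingType) n (H S : 'M[R]_n) : H *m H = 1%:M ->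
  char_poly (H *m S *m H) = char_poly S.
Proof.
move=> HH; pose HX := map_mx polyC H.
have HHX : HX *m HX = 1%:M by rewrite -map_mxM HH map_mx1.
have -> : char_poly (H *m S *m H) = \det (HX *m char_poly_mx S *m HX).
  congr (\det _); rewrite /char_poly_mx mulmxBr mulmxBl !map_mxM mul_mx_scalar -scalemxAl.
  by rewrite -/HX HHX scalemx1.
by rewrite !det_mulmx mulrAC -det_mulmx HHX det1 mul1r.
Qed.

Lemma char_poly_block (R : comNzRingType) n (a : R) (S : 'M[R]_n) :
  char_poly (block_mx (a%:M : 'M[R]_1) 0 0 S) = ('X - a%:P) * char_poly S.
Proof.
rewrite /char_poly /char_poly_mx map_block_mx !map_mx0 scalar_mx_block opp_block_mx add_block_mx.
by rewrite !oppr0 !addr0 det_ublock map_scalar_mx -raddfB/= det_scalar1.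
Qed.

(** Deflation: a reflection sends the first basis vector to a unit eigenvector for [lam 0], and the
    induction hypothesis treats the remaining block. The assumed factorisation supplies the
    eigenvalues and fixes their order. *)
Lemma symmetric_spectral (R : rcfType) n (S : 'M[R]_n) (lam : nat -> R) :
  S^T = S -> char_poly S = \prod_(i < n) ('X - (lam i)%:P) ->
  exists2 U : 'M[R]_n, U^T *m U = 1%:M & S = U *m diag_mx (\row_(i < n) lam i) *m U^T.
Proof.
elim: n S lam => [|n IHn].
  by move=> S lam _ _; exists 1%:M; rewrite ?trmx1 ?mul1mx// [LHS]flatmx0 [RHS]flatmx0.
suff ind (S : 'M[R]_(1 + n)) (lam : nat -> R) :
    S^T = S -> char_poly S = \prod_(i < n.+1) ('X - (lam i)%:P) ->
    exists2 U : 'M[R]_(1 + n), U^T *m U = 1%:M &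
      S = U *m diag_mx (\row_(i < 1 + n) lam i) *m U^T by move=> S lam; exact: ind.
move=> symS; rewrite big_ord_recl/= => chS.
have : eigenvalue S (lam 0%N).
  by rewrite eigenvalue_root_char chS rootM root_XsubC eqxx.
move=> /eigenvalueP [v vS v0].
pose nv := Num.sqrt ((v *m v^T) 0 0).
have vv0 : 0 < (v *m v^T) 0 0.
  by have := @sqnorm_gt0 _ _ v^T; rewrite trmxK trmx_eq0; apply.
pose w := nv^-1 *: v^T.
have wT : w^T = nv^-1 *: v by rewrite linearZ/= trmxK.
have w1 : (w^T *m w) 0 0 = 1.
  rewrite wT /w -scalemxAl -scalemxAr scalerA mxE -invfM -expr2.
  by rewrite sqr_sqrtr ?ltW// mulVf// gt_eqF.
have Sw : S *m w = lam 0%N *: w.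
  by rewrite /w -scalemxAr -{1}symS -trmx_mul vS linearZ/= !scalerA mulrC.
have [H [symH HH He]] := householder w1.
set e := col_mx 1%:M 0 in He.
pose M := H *m S *m H.
have symM : M^T = M by rewrite /M !trmx_mul symH symS mulmxA.
have Me : M *m e = lam 0%N *: e.
  by rewrite /M -mulmxA He -mulmxA Sw -scalemxAr -He mulmxA HH mul1mx.
(* The first column is a multiple of [e], and symmetry clears the first row as well. *)
have ME : M = block_mx (lam 0%N)%:M 0 0 (drsubmx M).
  have : M *m e = col_mx (ulsubmx M) (dlsubmx M).
    by rewrite -{1}[M]submxK mul_block_col !mulmx1 !mulmx0 !addr0.
  rewrite Me scale_col_mx scaler0 scalemx1 => /eq_col_mx [ul dl].
  rewrite -[LHS]submxK -ul -dl; congr block_mx.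
  by rewrite -[LHS]trmxK trmx_ursub symM -dl trmx0.
have [|//|U' U'U S'E] := IHn (drsubmx M) (fun i => lam i.+1).
- by rewrite trmx_drsub symM.
(* Cancelling the factor of [lam 0] leaves the factorisation along the shifted sequence. *)
- have := char_poly_conj S HH; rewrite -/M [X in char_poly X = _]ME char_poly_block chS.
  by move/(mulfI (negbT (polyXsubC_eq0 _))).
have diagE : diag_mx (\row_(i < 1 + n) lam i) =
    block_mx (lam 0%N)%:M 0 0 (diag_mx (\row_(i < n) lam i.+1)).
  have -> : \row_(i < 1 + n) lam i = row_mx (\row_(i < 1) lam 0%N) (\row_(i < n) lam i.+1).
    apply/matrixP => i j; rewrite !mxE; case: splitP => k jk; rewrite mxE jk//.
    by rewrite ord1.
  rewrite diag_mx_row; congr block_mx.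
  by apply/matrixP => i j; rewrite !ord1 !mxE.
exists (H *m block_mx 1%:M 0 0 U').
- rewrite trmx_mul symH -mulmxA (mulmxA H) HH mul1mx tr_block_mx mulmx_block.
  by rewrite !trmx0 trmx1 !(mul0mx, mulmx0, mul1mx, addr0, add0r) U'U -scalar_mx_block.
- rewrite trmx_mul symH diagE !mulmxA -[H *m _ *m _]mulmxA mulmx_block tr_block_mx !trmx0 trmx1.
  rewrite !(mul0mx, mulmx0, mul1mx, addr0, add0r) -[H *m _ *m _]mulmxA mulmx_block.
  rewrite !(mul0mx, mulmx0, mulmx1, addr0, add0r) -S'E -ME /M.
  by rewrite !mulmxA HH mul1mx -mulmxA HH mulmx1.
Qed.

(** * Water-filling *)

Section Capacity.
Variable R : realType.

Lemma posdefmx_diag n (d : 'rV[R]_n) : (forall i, 0 < d 0 i) -> posdefmx (diag_mx d).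
Proof.
move=> d0; split=> [|x x0]; first by rewrite tr_diag_mx.
have E : (x^T *m diag_mx d *m x) 0 0 = \sum_i d 0 i * x i 0 ^+ 2.
  by rewrite mul_mx_diag mxE; apply: eq_bigr => i _; rewrite !mxE; ring.
rewrite E lt0r sumr_ge0 ?andbT; last by move=> i _; rewrite mulr_ge0 ?sqr_ge0// ltW.
apply: contra x0; rewrite psumr_eq0 => [/allP h|i _]; last by rewrite mulr_ge0 ?sqr_ge0// ltW.
apply/eqP/matrixP => i j; rewrite ord1 [RHS]mxE.
have := h i (mem_index_enum _); rewrite /= mulf_eq0 gt_eqF//= sqrf_eq0.
by move=> /eqP.
Qed.

Lemma posdefmx_conj n (A U : 'M[R]_n) : U^T *m U = 1%:M -> posdefmx A ->
  posdefmx (U *m A *m U^T).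
Proof.
move=> UU [symA A0]; split=> [|x x0]; first by rewrite !trmx_mul trmxK symA mulmxA.
have := A0 (U^T *m x); rewrite trmx_mul trmxK !mulmxA; apply.
apply: contra x0 => /eqP/(congr1 (mulmx U)).
by rewrite mulmxA (mulmx1C UU) mul1mx mulmx0 => ->.
Qed.

Variables (N0 N1 : nat) (lam : nat -> R) (s2 : R).
Hypotheses (lam0 : forall i, (i < N0)%N -> 0 < lam i) (s20 : 0 < s2).

Notation D := (diag_mx (\row_(i < N0) lam i)).

(** Sylvester's identity writes the left side as [\det D * \det Y] in dimension [N0], and Hadamard's
    inequality is applied to [Y]. *)
Lemma det_channel_le (V : 'M[R]_(N1, N0)) :
  \det (s2%:M + V *m D *m V^T) / s2 ^+ N1 <=
  \prod_(i < N0) (lam i * ((lam i)^-1 + (V^T *m V) i i / s2)).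
Proof.
have s20' : s2 != 0 by rewrite gt_eqF.
pose Dv := diag_mx (\row_(i < N0) (lam i)^-1).
have DvD : Dv *m D = 1%:M.
  apply/matrixP => i j; rewrite mul_diag_mx !mxE.
  by case: eqP => _; rewrite ?mulr0n ?mulr0// mulr1n mulVf// gt_eqF// lam0.
pose Y := Dv + V^T *m s2^-1%:M *m V.
have pY : posdefmx Y.
  rewrite /Y -{2}[V]trmxK; apply: posdefmx_addcongr.
    by apply: posdefmx_diag => i; rewrite mxE invr_gt0 lam0.
  by apply: posdefmx_scalar; rewrite invr_gt0.
have -> : \det (s2%:M + V *m D *m V^T) / s2 ^+ N1 = \det Y * \prod_(i < N0) lam i.
  have -> : s2%:M + V *m D *m V^T = s2 *: (1%:M + (s2^-1 *: V *m D) *m V^T).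
    by rewrite scalerDr scalemx1 -!scalemxAl scalerA divff// scale1r.
  rewrite detZ mulrAC divff ?expf_neq0// mul1r det_addmulmxC.
  have -> : \prod_(i < N0) lam i = \det D.
    by rewrite det_diag; apply: eq_bigr => i _; rewrite mxE.
  rewrite -det_mulmx; congr (\det _).
  by rewrite /Y mulmxDl DvD mul_mx_scalar -!scalemxAl -scalemxAr mulmxA.
have /andP[_ YH] := det_posdefmx_hadamard pY.
rewrite big_split/= mulrC ler_wpM2l//; first by apply: prodr_ge0 => i _; rewrite ltW// lam0.
apply: (le_trans YH); rewrite le_eqVlt; apply/orP; left; apply/eqP; apply: eq_bigr => i _.
rewrite /Y; have -> : V^T *m s2^-1%:M *m V = s2^-1 *: (V^T *m V) by rewrite mul_mx_scalar -scalemxAl.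
have D00 (M N : 'M[R]_N0) : (M + N) i i = M i i + N i i by rewrite mxE.
have Z00 a (M : 'M[R]_N0) : (a *: M) i i = a * M i i by rewrite mxE.
by rewrite D00 Z00 !mxE eqxx mulr1n mulrC.
Qed.

Variables (k : nat) (F nu : R).
Hypotheses (kN0 : (k <= N0)%N) (kN1 : (k <= N1)%N) (nu0 : 0 < nu).
(** Division-free form of the power budget: the powers [s2 * (nu - (lam i)^-1)] over [i < k] add up
    to [F]. *)
Hypothesis nuE : nu * k%:R * s2 = F + s2 * \sum_(i < k) (lam i)^-1.

Lemma prod_head (f : nat -> R) n : (k <= n)%N ->
  \prod_(i < n) (if (i < k)%N then f i else 1) = \prod_(i < k) f i.
Proof. by move=> kn; rewrite (big_ord_widen n f kn) [RHS]big_mkcond. Qed.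

Lemma sum_head (f : nat -> R) n : (k <= n)%N ->
  \sum_(i < n) (if (i < k)%N then f i else 0) = \sum_(i < k) f i.
Proof. by move=> kn; rewrite (big_ord_widen n f kn) [RHS]big_mkcond. Qed.

(** Each factor is compared with its optimal value [g i] through [1 + x <= expR x]; the exponents
    then add up to [(\sum_i p i - F) / (s2 * nu)], which is at most zero. *)
Lemma waterfilling_le (p : 'I_N0 -> R) :
  (forall i : nat, (k <= i)%N -> (i < N0)%N -> nu * lam i <= 1) ->
  (forall i, 0 <= p i) -> \sum_i p i <= F ->
  \prod_(i < N0) (lam i * ((lam i)^-1 + p i / s2)) <= \prod_(i < k) (lam i * nu).
Proof.
move=> tail p0 pF; have s20' : s2 != 0 by rewrite gt_eqF.
have nu0' : nu != 0 by rewrite gt_eqF.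
pose g i := if (i < k)%N then lam i * nu else 1.
pose h i : R := if (i < k)%N then (lam i * nu)^-1 - 1 else 0.
have step (i : 'I_N0) : lam i * ((lam i)^-1 + p i / s2) <=
    g i * expR (h i + p i / (s2 * nu)).
  have li := lam0 (ltn_ord i); have li' : lam i != 0 by rewrite gt_eqF.
  have q0 : 0 <= p i / (s2 * nu) by apply: divr_ge0 => //; apply: mulr_ge0; exact: ltW.
  rewrite /g /h; case: ltnP => ik.
    have -> : lam i * ((lam i)^-1 + p i / s2) =
        lam i * nu * (1 + ((lam i * nu)^-1 - 1 + p i / (s2 * nu))).
      by field; rewrite li' s20' nu0'.
    by rewrite ler_wpM2l ?expR_ge1Dx// mulr_ge0// ltW.
  (* On an inactive mode [nu * lam i <= 1], so the power spent there gains at most what it would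
     gain at the water level. *)
  rewrite add0r mul1r (le_trans _ (expR_ge1Dx _))//.
  have -> : lam i * ((lam i)^-1 + p i / s2) = 1 + nu * lam i * (p i / (s2 * nu)).
    by field; rewrite li' s20' nu0'.
  by rewrite lerD2l ler_piMl// tail.
have lower (i : 'I_N0) : 0 <= lam i * ((lam i)^-1 + p i / s2).
  by rewrite mulr_ge0 ?addr_ge0 ?invr_ge0 ?divr_ge0 ?p0 ?ltW ?lam0.
apply: (@le_trans _ _ (\prod_(i < N0) (g i * expR (h i + p i / (s2 * nu))))).
  by apply: ler_prod => i _; rewrite lower step.
rewrite big_split/= -expR_sum /g (prod_head (fun i => lam i * nu) kN0) ler_piMr//.
  by apply: prodr_ge0 => i _; rewrite mulr_ge0// ltW// lam0// (leq_trans _ kN0).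
rewrite -expR0 ler_expR big_split/= /h (sum_head (fun i => (lam i * nu)^-1 - 1) kN0) -mulr_suml.
have -> : \sum_(i < k) ((lam i * nu)^-1 - 1) = nu^-1 * \sum_(i < k) (lam i)^-1 - k%:R.
  rewrite big_split/= sumrN sumr_const card_ord mulr_sumr; congr (_ - _).
  by apply: eq_bigr => i _; rewrite invfM mulrC.
have -> : k%:R = (F + s2 * \sum_(i < k) (lam i)^-1) / (s2 * nu).
  by rewrite -nuE; field; rewrite s20' nu0'.
set s := \sum_(i < k) _.
have -> : nu^-1 * s - (F + s2 * s) / (s2 * nu) + (\sum_i p i) / (s2 * nu) =
    (\sum_i p i - F) / (s2 * nu).
  by field; rewrite s20' nu0'.
by rewrite mulr_le0_ge0 ?subr_le0// invr_ge0 mulr_ge0// ltW.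
Qed.

(** Rectangular diagonal; the square root makes the squared norm of column [i] the power of mode
    [i]. *)
Definition waterfill_mx : 'M[R]_(N1, N0) :=
  \matrix_(i, j) (if (i == j :> nat) && (i < k)%N then Num.sqrt (s2 * (nu - (lam i)^-1)) else 0).

Hypothesis head : forall i, (i < k)%N -> (lam i)^-1 <= nu.

Lemma waterfill_mx_diag (d : nat -> R) :
  waterfill_mx *m diag_mx (\row_(i < N0) d i) *m waterfill_mx^T =
  diag_mx (\row_(i < N1) if (i < k)%N then s2 * (nu - (lam i)^-1) * d i else 0).
Proof.
apply/matrixP => i j; rewrite mul_mx_diag !mxE.
have [ik|ik] := ltnP i k; last first.
  by rewrite mul0rn big1// => l _; rewrite !mxE ltnNge ik andbF !mul0r.
pose l := Ordinal (leq_trans ik kN0).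
rewrite (bigD1 l)//= big1 ?addr0 => [|l' l'l]; last first.
  by rewrite !mxE [_ == _ :> nat]eq_sym -[nat_of_ord i]/(nat_of_ord l) val_eqE (negPf l'l) !mul0r.
rewrite !mxE eqxx ik/=; have [<-|ij] := eqVneq i j.
  rewrite eqxx ik mulr1n mulrAC -expr2 sqr_sqrtr// mulr_ge0 ?subr_ge0 ?head//.
  exact: ltW.
by rewrite [_ == _ :> nat]eq_sym val_eqE (negPf ij) mulr0 mulr0n.
Qed.

Lemma trace_waterfill_mx : \tr (waterfill_mx *m waterfill_mx^T) = F.
Proof.
have := waterfill_mx_diag (fun=> 1).
have -> : diag_mx (\row_(i < N0) (1 : R)) = 1%:M.
  by apply/matrixP => i j; rewrite !mxE.
rewrite mulmx1 => ->; rewrite mxtrace_diag.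
under eq_bigr do rewrite mxE mulr1.
rewrite (sum_head (fun i => s2 * (nu - (lam i)^-1)) kN1) -mulr_sumr big_split/= sumrN sumr_const card_ord -mulr_natr mulrBr.
by rewrite mulrC nuE addrK.
Qed.

Lemma det_waterfill_mx :
  \det (s2%:M + waterfill_mx *m D *m waterfill_mx^T) / s2 ^+ N1 = \prod_(i < k) (lam i * nu).
Proof.
have s20' : s2 != 0 by rewrite gt_eqF.
rewrite waterfill_mx_diag -diag_const_mx -raddfD/= det_diag.
rewrite -(prod_head (fun i => lam i * nu) kN1) -[X in s2 ^+ X]card_ord -prodr_const -prodf_div.
apply: eq_bigr => i _; rewrite !mxE; case: ltnP => ik; last by rewrite addr0 divff.
by field; rewrite s20' gt_eqF// lam0// (leq_trans ik).
Qed.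

End Capacity.

Lemma Sigma_xk_inv_trace (R : realType) (lam : nat -> R) k :
  (forall i, (i < k)%N -> lam i != 0) ->
  \tr (invmx (Sigma_xk lam k)) = \sum_(i < k) (lam i)^-1.
Proof.
move=> lam0; pose Dv := diag_mx (\row_(i < k) (lam i)^-1).
have DvD : Dv *m Sigma_xk lam k = 1%:M.
  apply/matrixP => i j; rewrite mul_diag_mx !mxE.
  by case: eqP => _; rewrite ?mulr0n ?mulr0// mulr1n mulVf// lam0.
have uS : Sigma_xk lam k \in unitmx by case: (mulmx1_unit DvD).
have -> : invmx (Sigma_xk lam k) = Dv by rewrite -[RHS](mulmxK uS) DvD mul1mx.
by rewrite mxtrace_diag; apply: eq_bigr => i _; rewrite mxE.
Qed.

Theorem theorem2 (R : realType) (N0 N1 : nat) (Sx : 'M[R]_N0) (lam : nat -> R)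
  (s2 F : R) (K : nat) :
  (1 <= N0)%N -> (1 <= N1)%N ->
  Sx^T = Sx ->
  char_poly Sx = \prod_(i < N0) ('X - (lam i)%:P) ->
  (forall i j : nat, (i <= j)%N -> (j < N0)%N -> lam j <= lam i) ->
  (forall i : nat, (i < N0)%N -> 0 < lam i) ->
  0 < s2 ->
  (1 <= K)%N -> (K < minn N0 N1)%N ->
  rho lam s2 (minn N0 N1 - K) <= F -> F <= rho lam s2 (minn N0 N1 - K).+1 ->
  MMI N1 Sx s2 F =
  ((((minn N0 N1 - K)%:R / 2) *
      ln ((F + s2 * \tr (invmx (Sigma_xk lam (minn N0 N1 - K))))
          / (s2 * (minn N0 N1 - K)%:R))
    + (1 / 2) * ln (\det (Sigma_xk lam (minn N0 N1 - K))))%:E)%E.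
Proof.
move=> _ _ symS chS mono lam0 s20 K0 KN.
set k := (minn N0 N1 - K)%N => Fge Fle.
have k0 : (0 < k)%N by rewrite subn_gt0.
(* Strictness comes from [K >= 1]; it makes [lam k], the first inactive mode, a genuine
   eigenvalue. *)
have [kN0 kN1] : (k < N0)%N /\ (k < N1)%N.
  by apply/andP; rewrite -leq_min /k ltn_subrL K0 (leq_ltn_trans _ KN).
have lamk i : (i < k)%N -> 0 < lam i by move=> ik; rewrite lam0// (ltn_trans ik).
rewrite Sigma_xk_inv_trace; last by move=> i ik; rewrite gt_eqF// lamk.
have -> : \det (Sigma_xk lam k) = \prod_(i < k) lam i.
  by rewrite det_diag; apply: eq_bigr => i _; rewrite mxE.
have s20' : s2 != 0 by rewrite gt_eqF.
have kR0 : 0 < k%:R :> R by rewrite ltr0n.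
set nu := (F + _) / _.
have nuE : nu * k%:R * s2 = F + s2 * \sum_(i < k) (lam i)^-1.
  by rewrite /nu; field; rewrite s20' gt_eqF.
have k1k : (k.-1 < k)%N by rewrite prednK.
(* The lower bound on [F] rearranged; [k.-1] is the last active mode in 0-indexed form. *)
have nu_ge : (lam k.-1)^-1 <= nu.
  rewrite /nu ler_pdivlMr ?mulr_gt0//; move: Fge; rewrite /rho; set s := \sum_(i < k) _.
  by rewrite -subr_ge0 => h; rewrite -subr_ge0 (le_trans h)// le_eqVlt; apply/orP; left; apply/eqP; ring.
(* In [rho] at [k.+1] the last summand cancels one of the [k.+1] copies of [(lam k)^-1], so the
   upper bound on [F] concerns the same [nu]. *)
have nu_le : nu <= (lam k)^-1.
  rewrite /nu ler_pdivrMr ?mulr_gt0//; move: Fle; rewrite /rho big_ord_recr/= -natr1.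
  set s := \sum_(i < k) _.
  by rewrite -subr_ge0 => h; rewrite -subr_ge0 (le_trans h)// le_eqVlt; apply/orP; left; apply/eqP; ring.
have nu0 : 0 < nu by rewrite (lt_le_trans _ nu_ge)// invr_gt0 lamk.
clearbody nu.
have head i : (i < k)%N -> (lam i)^-1 <= nu.
  move=> ik; apply: le_trans nu_ge; rewrite lef_pV2 ?posrE ?lamk//.
  by apply: mono; [rewrite -ltnS prednK | exact: ltn_trans kN0].
have tail i : (k <= i)%N -> (i < N0)%N -> nu * lam i <= 1.
  move=> ki iN; rewrite -ler_pdivlMr ?lam0// mul1r (le_trans nu_le)//.
  by rewrite lef_pV2 ?posrE ?lam0// mono.
have [U UU SE] := symmetric_spectral symS chS.
have pS : posdefmx Sx.
  by rewrite SE; apply: posdefmx_conj => //; apply: posdefmx_diag => i; rewrite mxE lam0.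
have prod0 : 0 < \prod_(i < k) (lam i * nu).
  by apply: prodr_gt0 => i _; rewrite mulr_gt0// lamk.
have -> : k%:R / 2 * ln nu + 1 / 2 * ln (\prod_(i < k) lam i) =
    1 / 2 * ln (\prod_(i < k) (lam i * nu)).
  have P0 : 0 < \prod_(i < k) lam i by apply: prodr_gt0 => i _; rewrite lamk.
  rewrite big_split/= prodr_const card_ord lnM ?posrE ?exprn_gt0// lnXn// -mulr_natl; ring.
(* Expresses the channel matrix in the eigenbasis of [Sx]. *)
have conjE (W : 'M[R]_(N1, N0)) : W *m Sx *m W^T =
    (W *m U) *m diag_mx (\row_(i < N0) lam i) *m (W *m U)^T.
  by rewrite {1}SE trmx_mul !mulmxA.
apply/eqP; rewrite eq_le; apply/andP; split.
  apply: ge_ereal_sup => _ [W /= WF] [b _ <-].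
  rewrite MI_capacity// lee_fin ler_wpM2l// ler_ln ?posrE//; last first.
    by rewrite divr_gt0 ?exprn_gt0// det_posdefmx_gt0//; exact: posdefmx_out.
  rewrite conjE; apply: le_trans (det_channel_le lam0 s20 _) _.
  apply: (waterfilling_le lam0 s20 (ltnW kN0) nu0 nuE tail).
    move=> i; rewrite mxE; apply: sumr_ge0 => j _; rewrite !mxE -expr2; exact: sqr_ge0.
  (* The power is unchanged by the orthogonal [U]. *)
  suff <- : \tr (W^T *m W) = \sum_i ((W *m U)^T *m (W *m U)) i i by [].
  rewrite -/(mxtrace _) [RHS]mxtrace_mulC trmx_mul !mulmxA -[W *m U *m U^T]mulmxA.
  by rewrite (mulmx1C UU) mulmx1 mxtrace_mulC.
apply: ereal_sup_ubound.
(* The water-filling matrix, rotated back from the eigenbasis. *)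
pose W := waterfill_mx N0 N1 lam s2 k nu *m U^T.
exists W => /=.
  rewrite mxtrace_mulC /W trmx_mul trmxK mulmxA -[_ *m U^T *m U]mulmxA UU mulmx1.
  by rewrite (trace_waterfill_mx s20 (ltnW kN0) (ltnW kN1) nuE head).
(* The mutual information does not depend on [b], so any offset serves. *)
exists 0 => //; rewrite MI_capacity// conjE /W -[_ *m U^T *m U]mulmxA UU mulmx1.
by rewrite (det_waterfill_mx lam0 s20 (ltnW kN0) (ltnW kN1) head).
Qed.
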